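(* Let $(W,S)$ be a Coxeter system, let $J\subseteq S$, and let $X\subseteq T$ be an order ideal of $(T,\sqsubseteq)$. Then the map $P^J:W\to W$ is order preserving on $(W,\leqslant_{L^X})$: $u\leqslant_{L^X}v$ implies $P^J(u)\leqslant_{L^X}P^J(v)$. In particular, this holds for the $k$-intermediate orders $\leqslant_{L^k}$, for every $k\in\mathbb N$.
   Context: $(W,S)$ is a Coxeter system with length function $\ell$, reflections $T=\{wsw^{-1}:w\in W,\ s\in S\}$ and Bruhat order $\leqslant$. For $X\subseteq T$, $u\leqslant_{L^X}v$ iff $u=v$, or $\ell(u)<\ell(v)$ and there exist $t_1,\dots,t_r\in X$ with $u<t_1u<\dots<t_r\cdots t_1u=v$ in the Bruhat order. For $k\in\mathbb N$, let $T_k=\{t\in T:(\ell(t)-1)/2\leqslant k\}$ and $\leqslant_{L^k}:=\leqslant_{L^{T_k}}$. The Bruhat graph $\Omega_{W,S}$ has vertex set $W$ and an arrow $u\to v$ iff $uv^{-1}\in T$ and $u<v$; $\Omega_{W,S}(Y)$ is its induced subgraph on $Y$. A reflection subgroup $W'$ (a subgroup generated by reflections) has canonical Coxeter generators $S'=\{t\in T:N(t)\cap W'=\{t\}\}$, where $N(v)=\{t\in T:\ell(tv)<\ell(v)\}$; it is dihedral if $|S'|=2$. $t\sqsubseteq' t'$ iff $t=t'$ or there is a dihedral reflection subgroup $W'\ni t,t'$ such that the directed distance from $t$ to $t'$ in $\Omega_{W,S}(W')$ is finite; $\sqsubseteq$ is the transitive closure of $\sqsubseteq'$. For $J\subseteq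 S$, $W_J$ is the subgroup generated by $J$ and $W^J=\{w\in W:\ell(w)<\ell(ws)\ \forall s\in J\}$. Every $w$ factors uniquely as $w=w^Jw_J$ with $w^J\in W^J$, $w_J\in W_J$ and $\ell(w)=\ell(w^J)+\ell(w_J)$. Set $P^J(w):=w^J$. *)

(* Defs.v *)
From Stdlib Require Import List Arith Relations.
Import ListNotations.
Set Implicit Arguments.

Record Group := {
  gcar :> Type;
  gmul : gcar -> gcar -> gcar;
  gone : gcar;
  ginv : gcar -> gcar;
  gmulA : forall x y z, gmul x (gmul y z) = gmul (gmul x y) z;
  gmul1l : forall x, gmul gone x = x;
  gmulVl : forall x, gmul (ginv x) x = gone }.

Arguments gmul {g} _ _.
Arguments gone {g}.
Arguments ginv {g} _.

Fixpoint gpow {G : Group} (x : G) (n : nat) : G :=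
  match n with 0 => gone | S n => gmul x (gpow x n) end.

Inductive generated {G : Group} (R : G -> Prop) : G -> Prop :=
| gen_one : generated R gone
| gen_l : forall r w, R r -> generated R w -> generated R (gmul r w)
| gen_li : forall r w, R r -> generated R w -> generated R (gmul (ginv r) w).

Definition is_hom {G H : Group} (f : G -> H) : Prop :=
  forall x y, f (gmul x y) = gmul (f x) (f y).

(** * Coxeter systems (W,S): S a generating set of involutions of W such that
    W has the presentation < S | (st)^{m(s,t)} = 1 >, m(s,t) the order of st
    (no relation when infinite).  The presentation is expressed by its
    universal property: any map f on S respecting these relations extends to
    a group homomorphism. *)
Record CoxeterSystem := {
  cW :> Group;
  cS : cW -> Prop;
  cS_generates : forall w, generated cS w;
  cS_invol : forall s, cS s -> s <> gone /\ gmul s s = gone;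
  cS_universal : forall (G : Group) (f : cW -> G),
    (forall s t n, cS s -> cS t -> gpow (gmul s t) n = gone ->
        gpow (gmul (f s) (f t)) n = gone) ->
    exists phi : cW -> G, is_hom phi /\ forall s, cS s -> phi s = f s }.

Section Coxeter.
Context {C : CoxeterSystem}.
Local Notation W := (cW C).

Definition word_prod (l : list W) : W := fold_right gmul gone l.

Definition is_len (w : W) (n : nat) : Prop :=
  (exists l, Forall (cS C) l /\ length l = n /\ word_prod l = w) /\
  (forall l, Forall (cS C) l -> word_prod l = w -> n <= length l).

Definition len_lt (u v : W) : Prop :=
  exists m n, is_len u m /\ is_len v n /\ m < n.

Definition refl (t : W) : Prop :=
  exists w s, cS C s /\ t = gmul (gmul w s) (ginv w).

Definition bruhat_step (u v : W) : Prop :=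
  exists t, refl t /\ v = gmul t u /\ len_lt u v.
Definition bruhat_le : W -> W -> Prop := clos_refl_trans W bruhat_step.
Definition bruhat_lt (u v : W) : Prop := bruhat_le u v /\ u <> v.

Definition leLX (X : W -> Prop) (u v : W) : Prop :=
  u = v \/
  (len_lt u v /\
   clos_refl_trans W (fun x y => exists t, X t /\ y = gmul t x /\ bruhat_lt x y) u v).

Definition Tk (k : nat) (t : W) : Prop :=
  refl t /\ exists n, is_len t n /\ (n - 1) / 2 <= k.
Definition leLk (k : nat) : W -> W -> Prop := leLX (Tk k).

Definition Nset (v t : W) : Prop := refl t /\ len_lt (gmul t v) v.

Definition reflection_subgroup (W' : W -> Prop) : Prop :=
  exists R : W -> Prop, (forall r, R r -> refl r) /\
    (forall w, W' w <-> generated R w).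
Definition canon_gens (W' : W -> Prop) (t : W) : Prop :=
  refl t /\ (forall t', (Nset t t' /\ W' t') <-> t' = t).
Definition dihedral (W' : W -> Prop) : Prop :=
  exists a b, a <> b /\ (forall t, canon_gens W' t <-> (t = a \/ t = b)).

Definition bg_arrow (u v : W) : Prop := refl (gmul u (ginv v)) /\ bruhat_lt u v.

Definition sqle' (t t' : W) : Prop :=
  refl t /\ refl t' /\
  (t = t' \/
   exists W' : W -> Prop, reflection_subgroup W' /\ dihedral W' /\ W' t /\ W' t' /\
     clos_refl_trans W (fun x y => W' x /\ W' y /\ bg_arrow x y) t t').
Definition sqle : W -> W -> Prop := clos_refl_trans W sqle'.

Definition order_ideal (X : W -> Prop) : Prop :=
  (forall t, X t -> refl t) /\
  (forall t t', refl t -> refl t' -> sqle t t' -> X t' -> X t).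

(** parabolic subgroups, W^J and P^J (as the relation  P^J(w) = x) *)
Definition WJ (J : W -> Prop) : W -> Prop := generated J.
Definition WupJ (J : W -> Prop) (w : W) : Prop :=
  forall s, J s -> len_lt w (gmul w s).
Definition isPJ (J : W -> Prop) (w x : W) : Prop :=
  WupJ J x /\ exists y, WJ J y /\ w = gmul x y /\
    exists a b, is_len w (a + b) /\ is_len x a /\ is_len y b.

End Coxeter.

(* Main.v *)
(* The universal property of W, applied to the semidirect product of W with the
   functions W -> bool, yields the cocycle whose value at w is the set N(w); the
   strong exchange condition follows from it.

   It suffices to treat one step u < t u with t in X, by induction on the length of
   t. As t is not in N(u), it is not in N(x) for x = P^J(u), so u may be replaced by
   x. If t x is not in W^J, choose s in J with t x s < t x. Either t x = x s, which
   has the same projection as x, or the dihedral group generated by t and x s x^-1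
   provides a chain x < t1 x < t2 t1 x = t x s in which t1 and t2 are strictly below
   t for the order on reflections; the induction hypothesis applies to both steps,
   and t x s has the same projection as t x. *)
Require Import Defs.
From Stdlib Require Import List Arith Lia Relations Bool.
From Stdlib Require Import Classical ClassicalEpsilon FunctionalExtensionality.

(* The obstacle is the order on reflections: [sqle'] asks for a reflection subgroup with exactly two
   canonical generators and a directed path inside it. For H generated by t and r = x s x^-1, both
   are extracted from the cocycle. Restricted to arguments in a subgroup H, the cocycle ignores a
   minimal coset representative, and the value of a canonical generator p is the indicator of p. So
   H computes N(w) ∩ H from its canonical generators by the rule that W follows with S. For dihedral
   H this determines N on alternating words, and both the lifting and the paths up to t become
   arithmetic with numbers of letters. The reflections t1 and t2 have fewer letters than t in H,
   hence smaller length in W, which drives the induction. The middle vertex t1 x need not lie in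
   W^J, so the induction runs over arbitrary elements and their projections. *)
Declare Scope grp_scope.
Local Open Scope grp_scope.
Local Notation "x ** y" := (gmul x y) (at level 40, left associativity) : grp_scope.
Local Notation "x ^-" := (ginv x) (at level 5, format "x ^-") : grp_scope.

(** * Groups, generated subgroups and alternating words *)

Section GroupTheory.
Context {G : Group}.
Implicit Types x y z : G.

Lemma gmulVr x : x ** x^- = gone.
Proof.
  rewrite <- (gmul1l _ (x ** x^-)), <- (gmulVl _ (x^-)) at 1.
  rewrite <- (gmulA _ (x^-^-) (x^-)), (gmulA _ (x^-) x), gmulVl, gmul1l.
  apply gmulVl.
Qed.

Lemma gmul1r x : x ** gone = x.
Proof. rewrite <- (gmulVl _ x), gmulA, gmulVr. apply gmul1l. Qed.

Lemma gmulKV x y : x ** (x^- ** y) = y.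
Proof. rewrite gmulA, gmulVr. apply gmul1l. Qed.

Lemma gmulVK x y : x^- ** (x ** y) = y.
Proof. rewrite gmulA, gmulVl. apply gmul1l. Qed.

Lemma gcancel_l x y z : x ** y = x ** z -> y = z.
Proof. intros E. rewrite <- (gmulVK x y), E. apply gmulVK. Qed.

Lemma gcancel_r x y z : y ** x = z ** x -> y = z.
Proof.
  intros E. rewrite <- (gmul1r y), <- (gmul1r z), <- (gmulVr x), !gmulA, E.
  reflexivity.
Qed.

Lemma ginv_uniq x y : x ** y = gone -> x^- = y.
Proof. intros E. apply (gcancel_l x). rewrite E. apply gmulVr. Qed.

Lemma ginvK x : x^-^- = x.
Proof. apply ginv_uniq, gmulVl. Qed.

Lemma ginv1 : (gone : G)^- = gone.
Proof. apply ginv_uniq, gmul1l. Qed.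

Lemma ginvM x y : (x ** y)^- = y^- ** x^-.
Proof. apply ginv_uniq. rewrite <- gmulA, gmulKV. apply gmulVr. Qed.

Lemma ginv_invol x : x ** x = gone -> x^- = x.
Proof. apply ginv_uniq. Qed.

Lemma gmul_invol_l x y : x ** x = gone -> x ** (x ** y) = y.
Proof. intros E. rewrite gmulA, E. apply gmul1l. Qed.

Lemma gmul_eq_r x y z : x ** y = z <-> x = z ** y^-.
Proof.
  split; intros E; subst; rewrite <- gmulA, ?gmulVr, ?gmulVl, gmul1r; reflexivity.
Qed.

Section Generated.
Variable P : G -> Prop.

Lemma generated_in x : P x -> generated P x.
Proof. intros H. rewrite <- (gmul1r x). apply gen_l; [exact H | constructor]. Qed.

Lemma generated_mul x y : generated P x -> generated P y -> generated P (x ** y).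
Proof.
  intros Hx Hy. induction Hx as [|r w Hr _ IH|r w Hr _ IH].
  - rewrite gmul1l; exact Hy.
  - rewrite <- gmulA. apply gen_l; assumption.
  - rewrite <- gmulA. apply gen_li; assumption.
Qed.

Lemma generated_inv x : generated P x -> generated P (x^-).
Proof.
  intros Hx. induction Hx as [|r w Hr _ IH|r w Hr _ IH].
  - rewrite ginv1. constructor.
  - rewrite ginvM. apply generated_mul; [exact IH|].
    rewrite <- (gmul1r (r^-)). apply gen_li; [exact Hr | constructor].
  - rewrite ginvM, ginvK. apply generated_mul; [exact IH|].
    apply generated_in, Hr.
Qed.
End Generated.

Lemma generated_bind (P Q : G -> Prop) x :
  (forall y, P y -> generated Q y) -> generated P x -> generated Q x.
Proof.
  intros HPQ Hx. induction Hx as [|r w Hr _ IH|r w Hr _ IH].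
  - constructor.
  - apply generated_mul; auto.
  - apply generated_mul; auto using generated_inv.
Qed.

Lemma generated_comm (P : G -> Prop) x y :
  (forall a b, P a -> P b -> a ** b = b ** a) ->
  generated P x -> generated P y -> x ** y = y ** x.
Proof.
  intros HP Hx Hy.
  assert (inv_comm : forall a b : G, a ** b = b ** a -> a^- ** b = b ** a^-).
  { intros a b E. apply (gcancel_l a), (gcancel_r a).
    rewrite gmulKV, <- !gmulA, gmulVl, gmul1r. symmetry; exact E. }
  assert (mul_comm : forall a b c : G, a ** c = c ** a -> b ** c = c ** b ->
            (a ** b) ** c = c ** (a ** b)).
  { intros a b c E1 E2. rewrite <- gmulA, E2, gmulA, E1, gmulA. reflexivity. }
  assert (Hgen : forall a, P a -> a ** y = y ** a).
  { intros a Ha. induction Hy as [|r w Hr _ IH|r w Hr _ IH].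
    - rewrite gmul1l. apply gmul1r.
    - symmetry. apply mul_comm; [auto | symmetry; exact IH].
    - symmetry. apply mul_comm; [auto | symmetry; exact IH]. }
  induction Hx as [|r w Hr _ IH|r w Hr _ IH].
  - rewrite gmul1l, gmul1r. reflexivity.
  - auto.
  - auto.
Qed.

(** For involutions, words with an odd number of letters are palindromes, hence conjugates of [x] or
    [y]; those with an even number are powers of [x y]. *)
Fixpoint alt x y (n : nat) : G :=
  match n with 0 => gone | S m => x ** alt y x m end.

Lemma alt_even_add x y i n : alt x y (2 * i + n) = alt x y (2 * i) ** alt x y n.
Proof.
  induction i as [|i IH]; [symmetry; apply gmul1l|].
  replace (2 * S i + n) with (S (S (2 * i + n))) by lia.
  replace (2 * S i) with (S (S (2 * i))) by lia.
  cbn [alt]. rewrite IH, !gmulA. reflexivity.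
Qed.

Lemma alt_odd_add x y i n : alt x y (2 * i + 1 + n) = alt x y (2 * i + 1) ** alt y x n.
Proof.
  replace (2 * i + 1 + n) with (2 * i + (1 + n)) by lia.
  rewrite !alt_even_add. cbn. rewrite gmul1r, gmulA. reflexivity.
Qed.

Lemma alt_even_S x y i : alt x y (2 * i) ** x = alt x y (2 * i + 1).
Proof. rewrite alt_even_add. cbn. rewrite gmul1r. reflexivity. Qed.

Lemma alt_odd_S x y i : alt x y (2 * i + 1) ** y = alt x y (2 * S i).
Proof.
  replace (2 * S i) with (2 * i + 1 + 1) by lia.
  rewrite alt_odd_add. cbn. rewrite gmul1r. reflexivity.
Qed.

Lemma gpow_alt x y n : gpow (x ** y) n = alt x y (2 * n).
Proof.
  induction n as [|n IH]; [reflexivity|].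
  replace (2 * S n) with (S (S (2 * n))) by lia.
  cbn [alt gpow]. rewrite IH, gmulA. reflexivity.
Qed.

Lemma alt_odd_conj x y i : x ** alt y x (2 * i + 1) ** x = alt x y (2 * S i + 1).
Proof.
  rewrite <- gmulA, alt_odd_S.
  replace (2 * S i + 1) with (S (2 * S i)) by lia. reflexivity.
Qed.

End GroupTheory.

Create HintDb grp.
#[local] Hint Rewrite <- gmulA : grp.
#[local] Hint Rewrite @gmul1l @gmul1r @gmulVl @gmulVr @gmulKV @gmulVK @ginvM @ginvK @ginv1 : grp.
Local Ltac gsimp := autorewrite with grp.
Local Ltac gsimp_invol :=
  repeat (progress (gsimp; repeat match goal with
    h : ?x ** ?x = gone |- _ =>
      progress rewrite ?(gmul_invol_l x _ h), ?h, ?(ginv_invol x h) end)).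

Section InvolutiveAlt.
Context {G : Group}.

Lemma alt_odd_invol (x y : G) i : x ** x = gone -> y ** y = gone ->
  alt x y (2 * i + 1) ** alt x y (2 * i + 1) = gone.
Proof.
  revert x y. induction i as [|i IH]; intros x y xx yy.
  - cbn. rewrite gmul1r. exact xx.
  - rewrite <- alt_odd_conj. gsimp.
    rewrite (gmul_invol_l x _ xx).
    rewrite (gmul_invol_l _ _ (IH y x yy xx)). exact xx.
Qed.

(** The palindrome ends in the inverse of the word with [n] letters, so [n] of its letters
    cancel. *)
Lemma alt_odd_cancel (x y : G) n d : x ** x = gone -> y ** y = gone ->
  alt x y (2 * (n + d) + 1) ** alt x y n = alt x y (n + 2 * d + 1).
Proof.
  revert x y. induction n as [|n IH]; intros x y xx yy.
  - apply gmul1r.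
  - replace (S n + d) with (S (n + d)) by lia.
    rewrite <- alt_odd_conj. cbn [alt Nat.add]. gsimp.
    rewrite (gmul_invol_l x _ xx). rewrite IH by assumption.
    reflexivity.
Qed.

Lemma alt_even_swap (x y : G) i : x ** x = gone ->
  alt x y (2 * i) = gone -> alt y x (2 * i) = gone.
Proof.
  intros xx E. apply (gcancel_l x).
  change (x ** alt y x (2 * i)) with (alt x y (S (2 * i))).
  replace (S (2 * i)) with (2 * i + 1) by lia.
  rewrite <- alt_even_S, E, gmul1l, gmul1r. reflexivity.
Qed.

(** Letters of the relation move one by one to the other side, where they appear inverted. *)
Lemma alt_fold (x y : G) m a b : x ** x = gone -> y ** y = gone ->
  alt x y (2 * m) = gone -> a + b = 2 * m -> alt x y a = alt y x b.
Proof.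
  intros xx yy E. revert x y a xx yy E.
  induction b as [|b IH]; intros x y a xx yy E Eab.
  - replace a with (2 * m) by lia. exact E.
  - cbn [alt]. rewrite <- (IH y x (S a) yy xx); [|apply alt_even_swap; assumption|lia].
    cbn [alt]. rewrite (gmul_invol_l y _ yy). reflexivity.
Qed.
End InvolutiveAlt.

Section Coxeter.
Context {C : CoxeterSystem}.
Local Notation W := (cW C).
Implicit Types u v w x y z t r p q : W.

Definition eqW x y : bool := if excluded_middle_informative (x = y) then true else false.

Lemma eqWP x y : eqW x y = true <-> x = y.
Proof. unfold eqW. destruct excluded_middle_informative; intuition congruence. Qed.

Lemma eqW_neq x y : x <> y -> eqW x y = false.
Proof. unfold eqW. destruct excluded_middle_informative; intuition congruence. Qed.

Lemma eqW_iff x y x' y' : (x = y <-> x' = y') -> eqW x y = eqW x' y'.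
Proof. intros H. apply eq_iff_eq_true. rewrite !eqWP. exact H. Qed.

Lemma S_invol s : cS C s -> s ** s = gone.
Proof. intros H. apply (cS_invol _ _ H). Qed.

(** * The reflection cocycle *)

Lemma coc_mulA (a b c : W * (W -> bool)) :
  let mul a b := (fst a ** fst b,
     fun u => xorb (snd a u) (snd b ((fst a)^- ** u ** fst a))) in
  mul a (mul b c) = mul (mul a b) c.
Proof.
  destruct a as [a f], b as [b g], c as [c h]; cbn. rewrite gmulA. f_equal.
  extensionality u. rewrite xorb_assoc. gsimp. reflexivity.
Qed.

(* W acting on the functions W -> bool by conjugation of the argument: the
   semidirect product that carries a cocycle W * W -> bool. *)
Definition coc_group : Group.
Proof.
  refine {|
    gcar := (W * (W -> bool))%type;
    gmul a b := (fst a ** fst b,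
      fun u => xorb (snd a u) (snd b ((fst a)^- ** u ** fst a)));
    gone := (gone, fun _ => false);
    ginv a := ((fst a)^-, fun u => snd a (fst a ** u ** (fst a)^-)) |}.
  - intros a b c. apply coc_mulA.
  - intros [a f]; cbn. rewrite gmul1l. f_equal. extensionality u.
    gsimp. reflexivity.
  - intros [a f]; cbn. rewrite gmulVl. f_equal. extensionality u.
    gsimp. apply xorb_nilpotent.
Defined.

Definition coc_gen s : coc_group := (s, fun u => eqW u s).

Fixpoint xsum (f : nat -> bool) (n : nat) : bool :=
  match n with 0 => false | S m => xorb (f 0) (xsum (fun i => f (S i)) m) end.

Lemma xsum_ext f g n : (forall i, f i = g i) -> xsum f n = xsum g n.
Proof.
  intros E. replace g with f; [reflexivity|]. extensionality i. apply E.
Qed.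

Lemma xsum_add f n m : xsum f (n + m) = xorb (xsum f n) (xsum (fun i => f (n + i)) m).
Proof.
  revert f. induction n as [|n IH]; intros f; cbn.
  - destruct (xsum _ m); reflexivity.
  - rewrite IH, xorb_assoc. reflexivity.
Qed.

Lemma fst_alt_coc s t n :
  fst (alt (coc_gen s) (coc_gen t) n : W * (W -> bool)) = alt s t n.
Proof.
  revert s t. induction n as [|n IH]; intros s t; [reflexivity|].
  cbn. rewrite IH. reflexivity.
Qed.

(** The prefixes of the word cross the walls [s], [s t s], [s t s t s], ...; the second component
    counts modulo 2 how often [u] occurs among them. *)
Lemma snd_alt_coc s t n u : s ** s = gone -> t ** t = gone ->
  snd (alt (coc_gen s) (coc_gen t) n : W * (W -> bool)) u =
  xsum (fun i => eqW u (alt s t (2 * i + 1))) n.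
Proof.
  intros ss tt. revert s t ss tt u. induction n as [|n IH]; intros s t ss tt u; [reflexivity|].
  cbn [xsum]. replace (alt s t (2 * 0 + 1)) with s by (symmetry; apply gmul1r).
  change (snd (alt (coc_gen s) (coc_gen t) (S n) : W * (W -> bool)) u) with
    (xorb (eqW u s) (snd (alt (coc_gen t) (coc_gen s) n : W * (W -> bool)) (s^- ** u ** s))).
  rewrite (ginv_invol s ss), IH by assumption. f_equal.
  apply xsum_ext. intros i. apply eqW_iff. rewrite <- (alt_odd_conj s t i).
  split; intros E.
  - rewrite <- E. gsimp. rewrite ss, gmul_invol_l by exact ss. gsimp. reflexivity.
  - rewrite E. gsimp. rewrite ss, gmul_invol_l by exact ss. gsimp. reflexivity.
Qed.

(** When [(s t)^n = 1], the walls number [i] and [n + i] of the word with [2 n] letters coincide, so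
    each is counted an even number of times. *)
Lemma coc_relations s t n : cS C s -> cS C t -> gpow (s ** t) n = gone ->
  gpow (coc_gen s ** coc_gen t) n = gone.
Proof.
  intros Hs Ht. apply S_invol in Hs, Ht. rewrite !gpow_alt. intros E.
  apply injective_projections.
  - rewrite fst_alt_coc. exact E.
  - extensionality u. rewrite snd_alt_coc by assumption. cbn [snd gone coc_group].
    replace (2 * n) with (n + n) by lia. rewrite xsum_add.
    rewrite (xsum_ext (fun i => eqW u (alt s t (2 * (n + i) + 1)))
                      (fun i => eqW u (alt s t (2 * i + 1)))).
    + apply xorb_nilpotent.
    + intros i. replace (2 * (n + i) + 1) with (2 * n + (2 * i + 1)) by lia.
      rewrite alt_even_add, E, gmul1l. reflexivity.
Qed.

Lemma hom_one {G H : Group} (f : G -> H) : is_hom f -> f gone = gone.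
Proof.
  intros Hf. apply (gcancel_l (f gone)). rewrite <- Hf, gmul1l, gmul1r. reflexivity.
Qed.

Lemma hom_inv {G H : Group} (f : G -> H) (x : G) : is_hom f -> f (x^-) = (f x)^-.
Proof.
  intros Hf. symmetry. apply ginv_uniq. rewrite <- Hf, gmulVr. apply hom_one, Hf.
Qed.

Lemma cocycle_exists : exists eta : W -> W -> bool,
  (forall x y u, eta (x ** y) u = xorb (eta x u) (eta y (x^- ** u ** x))) /\
  (forall s u, cS C s -> eta s u = eqW u s).
Proof.
  destruct (cS_universal C coc_group coc_gen) as (phi & Hphi & Hgen).
  { exact coc_relations. }
  assert (Hfst : forall w, fst (phi w) = w).
  { intros w. induction (cS_generates C w) as [|r w Hr _ IH|r w Hr _ IH].
    - rewrite (hom_one _ Hphi). reflexivity.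
    - rewrite Hphi, (Hgen _ Hr). cbn. rewrite IH. reflexivity.
    - rewrite Hphi, (hom_inv _ _ Hphi), (Hgen _ Hr). cbn. rewrite IH. reflexivity. }
  exists (fun w => snd (phi w)). split.
  - intros x y u. rewrite Hphi. cbn. rewrite Hfst. reflexivity.
  - intros s u Hs. rewrite (Hgen _ Hs). reflexivity.
Qed.

Definition bool_group : Group.
Proof.
  refine {| gcar := bool; gmul := xorb; gone := false; ginv b := b |}.
  - intros x y z. symmetry. apply xorb_assoc.
  - intros []; reflexivity.
  - apply xorb_nilpotent.
Defined.

(** Parity is what separates reflections from rotations in dihedral subgroups. *)
Lemma sign_exists : exists sgn : W -> bool,
  (forall x y, sgn (x ** y) = xorb (sgn x) (sgn y)) /\
  (forall s, cS C s -> sgn s = true).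
Proof.
  destruct (cS_universal C bool_group (fun _ => true)) as (phi & Hphi & Hgen).
  - intros s t n _ _ _. induction n as [|n IH]; [reflexivity|].
    cbn [gpow]. rewrite IH. reflexivity.
  - exists phi. split; assumption.
Qed.

(* eta w u decides whether the reflection u lies in N(w); see [eta_len]. *)
Definition eta : W -> W -> bool :=
  proj1_sig (constructive_indefinite_description _ cocycle_exists).

Definition sgn : W -> bool :=
  proj1_sig (constructive_indefinite_description _ sign_exists).

Lemma eta_mul x y u : eta (x ** y) u = xorb (eta x u) (eta y (x^- ** u ** x)).
Proof. unfold eta. destruct constructive_indefinite_description as (e & H1 & H2). apply H1. Qed.

Lemma eta_S s u : cS C s -> eta s u = eqW u s.
Proof. unfold eta. destruct constructive_indefinite_description as (e & H1 & H2). apply H2. Qed.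

Lemma sgn_mul x y : sgn (x ** y) = xorb (sgn x) (sgn y).
Proof. unfold sgn. destruct constructive_indefinite_description as (e & H1 & H2). apply H1. Qed.

Lemma sgn_S s : cS C s -> sgn s = true.
Proof. unfold sgn. destruct constructive_indefinite_description as (e & H1 & H2). apply H2. Qed.

Lemma sgn_one : sgn gone = false.
Proof.
  pose proof (sgn_mul gone gone) as E. rewrite gmul1l, xorb_nilpotent in E. exact E.
Qed.

Lemma sgn_inv w : sgn (w^-) = sgn w.
Proof.
  pose proof (sgn_mul (w^-) w) as E. rewrite gmulVl, sgn_one in E.
  symmetry in E. apply xorb_eq in E. exact E.
Qed.

Lemma sgn_refl t : refl t -> sgn t = true.
Proof.
  intros (w & s & Hs & ->). rewrite !sgn_mul, sgn_inv, (sgn_S _ Hs).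
  destruct (sgn w); reflexivity.
Qed.

Lemma eta_one u : eta gone u = false.
Proof.
  pose proof (eta_mul gone gone u) as E. rewrite gmul1l, ginv1 in E.
  rewrite gmul1l, gmul1r, xorb_nilpotent in E. exact E.
Qed.

Lemma eta_inv w u : eta (w^-) u = eta w (w ** u ** w^-).
Proof.
  pose proof (eta_mul (w^-) w u) as E. rewrite gmulVl, eta_one, ginvK in E.
  symmetry in E. apply xorb_eq in E. exact E.
Qed.

Lemma refl_invol t : refl t -> t ** t = gone.
Proof.
  intros (w & s & Hs & ->). gsimp. rewrite (gmul_invol_l s _ (S_invol _ Hs)).
  gsimp. reflexivity.
Qed.

Lemma refl_inv t : refl t -> t^- = t.
Proof. intros H. apply ginv_invol, refl_invol, H. Qed.

Lemma refl_conj w t : refl t -> refl (w ** t ** w^-).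
Proof.
  intros (x & s & Hs & ->). exists (w ** x), s. split; [exact Hs|].
  gsimp. reflexivity.
Qed.

Lemma refl_S s : cS C s -> refl s.
Proof. intros H. exists gone, s. split; [exact H|]. gsimp. reflexivity. Qed.

(** For [t = w s w^-1] the contributions of [w] and of [w^-1] at [t] cancel; the middle letter
    contributes the value of [s] at [s]. *)
Lemma eta_refl t : refl t -> eta t t = true.
Proof.
  intros (w & s & Hs & Et). rewrite Et at 1. rewrite !eta_mul, eta_inv, (eta_S _ _ Hs).
  replace (w^- ** t ** w) with s by (rewrite Et; gsimp; reflexivity).
  replace ((w ** s)^- ** t ** (w ** s)) with s by (rewrite Et; gsimp; reflexivity).
  rewrite <- Et, (proj2 (eqWP s s) eq_refl).
  destruct (eta w t); reflexivity.
Qed.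

(** * Lengths and the exchange condition *)

Lemma word_prod_cons s (l : list W) : word_prod (s :: l) = s ** word_prod l.
Proof. reflexivity. Qed.

Lemma word_exists (P : W -> Prop) w : (forall s, P s -> cS C s) -> generated P w ->
  exists l, Forall P l /\ word_prod l = w.
Proof.
  intros HP Hw. induction Hw as [|r w Hr _ [l [Hl E]]|r w Hr _ [l [Hl E]]].
  - exists nil. split; [constructor | reflexivity].
  - exists (r :: l). split; [constructor; assumption | rewrite word_prod_cons, E; reflexivity].
  - exists (r :: l). split; [constructor; assumption |].
    rewrite word_prod_cons, E, (ginv_invol r (S_invol _ (HP _ Hr))). reflexivity.
Qed.

Lemma nat_least (P : nat -> Prop) : (exists n, P n) ->
  exists n, P n /\ forall m, P m -> n <= m.
Proof.
  intros [n Hn]. apply NNPP. intros Hno. revert Hn.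
  induction n as [n IH] using lt_wf_ind. intros Hn. apply Hno. exists n. split; [exact Hn|].
  intros m Hm. destruct (le_lt_dec n m) as [|Hlt]; [assumption|].
  destruct (IH m Hlt Hm).
Qed.

Lemma is_len_exists w : exists n, is_len w n.
Proof.
  destruct (nat_least (fun n => exists l, Forall (cS C) l /\ length l = n /\ word_prod l = w))
    as (n & Hn & Hmin).
  - destruct (word_exists (cS C) w) as (l & Hl & E); [auto | apply cS_generates|].
    exists (length l), l. auto.
  - exists n. split; [exact Hn|]. intros l Hl E. apply Hmin. exists l. auto.
Qed.

Definition len w : nat := proj1_sig (constructive_indefinite_description _ (is_len_exists w)).

Lemma lenP w : is_len w (len w).
Proof. unfold len. apply proj2_sig. Qed.

Lemma is_len_uniq w n : is_len w n -> n = len w.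
Proof.
  intros [(l & Hl & El & E) Hmin]. destruct (lenP w) as [(l' & Hl' & El' & E') Hmin'].
  apply Nat.le_antisymm; [rewrite <- El' | rewrite <- El]; auto.
Qed.

Lemma len_ltP u v : len_lt u v <-> len u < len v.
Proof.
  split.
  - intros (m & n & Hm & Hn & H). apply is_len_uniq in Hm, Hn. congruence.
  - intros H. exists (len u), (len v). auto using lenP.
Qed.

(** An odd number of crossings of [u] means at least one; deleting the letter that crosses it
    multiplies by [u]. With [P] a subset of the generators, both [u] and the shorter word stay in
    the parabolic subgroup. *)
Lemma exchange (P : W -> Prop) l u : (forall s, P s -> cS C s) -> Forall P l ->
  eta (word_prod l) u = true ->
  generated P u /\
  exists l', Forall P l' /\ length l = S (length l') /\ u ** word_prod l = word_prod l'.
Proof.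
  intros HP Hl. revert u. induction Hl as [|s l Hs Hl IH]; intros u H.
  - cbn in H. rewrite eta_one in H. discriminate.
  - pose proof (S_invol _ (HP _ Hs)) as ss.
    rewrite word_prod_cons, eta_mul, (eta_S _ _ (HP _ Hs)) in H.
    destruct (classic (u = s)) as [->|Hne].
    + split; [apply generated_in, Hs|]. exists l. repeat split; [exact Hl|].
      rewrite word_prod_cons. apply gmul_invol_l, ss.
    + rewrite (eqW_neq _ _ Hne) in H. cbn in H.
      destruct (IH _ H) as (Hu & l' & Hl' & E & E'). split.
      * replace u with (s ** (s^- ** u ** s) ** s^-) by (gsimp; reflexivity).
        pose proof (generated_in P s Hs). auto using generated_mul, generated_inv.
      * exists (s :: l'). split; [constructor; assumption|]. split; [cbn; congruence|].
        rewrite !word_prod_cons, <- E'. gsimp. reflexivity.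
Qed.

Lemma eta_true_len w u : eta w u = true -> len (u ** w) < len w.
Proof.
  intros H. destruct (lenP w) as [(l & Hl & El & E) _]. rewrite <- E in H.
  destruct (exchange (cS C) l u (fun _ h => h) Hl H) as (_ & l' & Hl' & E1 & E2).
  rewrite E in E2. destruct (lenP (u ** w)) as [_ Hmin].
  specialize (Hmin l' Hl' (eq_sym E2)). lia.
Qed.

Lemma eta_false_len w t : refl t -> eta w t = false -> len w < len (t ** w).
Proof.
  intros Ht H. rewrite <- (gmul_invol_l t w (refl_invol _ Ht)) at 1.
  apply eta_true_len. rewrite eta_mul, (eta_refl _ Ht), (refl_inv _ Ht).
  rewrite (refl_invol _ Ht), gmul1l, H. reflexivity.
Qed.

Lemma eta_len w t : refl t -> eta w t = true <-> len (t ** w) < len w.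
Proof.
  intros Ht. split; [apply eta_true_len|]. intros H.
  destruct (eta w t) eqn:E; [reflexivity|]. pose proof (eta_false_len _ _ Ht E). lia.
Qed.

Lemma word_wall_refl l u : Forall (cS C) l ->
  eta (word_prod l) u = true -> refl u.
Proof.
  intros Hl. revert u. induction Hl as [|s l Hs Hl IH]; intros u H.
  - cbn in H. rewrite eta_one in H. discriminate.
  - rewrite word_prod_cons, eta_mul, (eta_S _ _ Hs) in H.
    destruct (classic (u = s)) as [->|Hne]; [apply refl_S, Hs|].
    rewrite (eqW_neq _ _ Hne) in H. apply IH, (refl_conj s) in H. revert H.
    gsimp. auto.
Qed.

Lemma eta_true_refl w u : eta w u = true -> refl u.
Proof.
  intros H. destruct (lenP w) as [(l & Hl & _ & E) _]. rewrite <- E in H.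
  apply (word_wall_refl l u Hl H).
Qed.

Lemma Nset_eta v t : Nset v t <-> eta v t = true.
Proof.
  split.
  - intros [Ht H]. apply eta_len; [exact Ht | apply len_ltP, H].
  - intros H. pose proof (eta_true_refl _ _ H) as Ht. split; [exact Ht|].
    apply len_ltP, eta_len; assumption.
Qed.

Lemma bruhat_le_len u v : bruhat_le u v -> u = v \/ len u < len v.
Proof.
  intros H. induction H as [u v (t & _ & _ & H)|u|u v w _ IH1 _ IH2].
  - right. apply len_ltP, H.
  - left. reflexivity.
  - destruct IH1 as [->|IH1]; [exact IH2|]. right.
    destruct IH2 as [<-|IH2]; lia.
Qed.

Lemma bruhat_lt_refl x t : refl t -> bruhat_lt x (t ** x) <-> eta x t = false.
Proof.
  intros Ht. split.
  - intros [H Hne]. destruct (eta x t) eqn:E; [|reflexivity].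
    apply eta_true_len in E. destruct (bruhat_le_len _ _ H); [contradiction | lia].
  - intros E. pose proof (eta_false_len _ _ Ht E) as H. split.
    + apply rt_step. exists t. rewrite len_ltP. auto.
    + intros E'. rewrite <- E' in H. lia.
Qed.

(** * Canonical generators of reflection subgroups *)

Definition is_subgroup (H : W -> Prop) : Prop :=
  H gone /\ (forall x y, H x -> H y -> H (x ** y)) /\ (forall x, H x -> H (x^-)).

Lemma generated_subgroup (P : W -> Prop) : is_subgroup (generated P).
Proof.
  split; [constructor|]. split; [apply generated_mul | apply generated_inv].
Qed.

(** The form in which minimality of [x] in the coset [H x] is used. *)
Definition eta_trivial (H : W -> Prop) x : Prop := forall u, H u -> eta x u = false.

Definition canonical (H : W -> Prop) p : Prop :=
  H p /\ refl p /\ forall u, H u -> eta p u = eqW u p.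

Lemma canonicalP (H : W -> Prop) p : canonical H p <-> canon_gens H p.
Proof.
  split.
  - intros (Hp & Rp & Ep). split; [exact Rp|]. intros u. rewrite Nset_eta. split.
    + intros [Eu Hu]. rewrite (Ep _ Hu) in Eu. apply eqWP, Eu.
    + intros ->. auto using eta_refl.
  - intros [Rp Ep]. split; [apply Ep; reflexivity|]. split; [exact Rp|].
    intros u Hu. apply eq_iff_eq_true. rewrite eqWP, <- Nset_eta, <- (Ep u). tauto.
Qed.

Lemma coset_min (H : W -> Prop) x : is_subgroup H ->
  exists a x0, H a /\ x = a ** x0 /\ eta_trivial H x0.
Proof.
  intros (H1 & HM & HV).
  destruct (nat_least (fun n => exists a, H a /\ len (a ** x) = n)) as (n & (a & Ha & En) & Hmin).
  { exists (len (gone ** x)), gone. auto. }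
  exists (a^-), (a ** x). split; [auto|]. split; [gsimp; reflexivity|].
  intros u Hu. destruct (eta (a ** x) u) eqn:E; [|reflexivity].
  apply eta_true_len in E. rewrite gmulA in E.
  specialize (Hmin (len (u ** a ** x))).
  assert (n <= len (u ** a ** x)) by (apply Hmin; exists (u ** a); auto). lia.
Qed.

(** Conjugation by [a] preserves [H], so [x0] contributes nothing. This transfers questions about
    [x = a x0] to the element [a] of [H]. *)
Lemma eta_coset (H : W -> Prop) a x0 u : is_subgroup H -> eta_trivial H x0 ->
  H a -> H u -> eta (a ** x0) u = eta a u.
Proof.
  intros (_ & HM & HV) Hx Ha Hu. rewrite eta_mul, Hx; [apply xorb_false_r|auto].
Qed.

Lemma eta_wall (H : W -> Prop) y s u : eta_trivial H y -> cS C s -> H u ->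
  eta (y ** s) u = eqW u (y ** s ** y^-).
Proof.
  intros Hy Hs Hu. rewrite eta_mul, (Hy _ Hu), (eta_S _ _ Hs). cbn. apply eqW_iff.
  split; [intros <- | intros ->]; gsimp; reflexivity.
Qed.

(** With [p = y s y^-1] one has [p y = y s]: on [H] the left side has the values of [p], and the
    right side crosses the single wall [p]. *)
Lemma canonical_wall (H : W -> Prop) y s : is_subgroup H -> eta_trivial H y ->
  cS C s -> H (y ** s ** y^-) -> canonical H (y ** s ** y^-).
Proof.
  intros HH Hy Hs Hp. split; [exact Hp|]. split; [apply refl_conj, refl_S, Hs|].
  intros u Hu. rewrite <- (eta_coset H _ y u HH Hy Hp Hu), <- (eta_wall H); auto.
  gsimp. reflexivity.
Qed.

(* Follow the gallery y, y s1, y s1 s2, ...: the first wall that belongs to H is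
   canonical, and conjugating by it deletes a letter of l. *)
Lemma refl_generated_canonical (H : W -> Prop) l y s : is_subgroup H -> eta_trivial H y ->
  Forall (cS C) l -> cS C s ->
  let r := y ** word_prod l ** s ** (y ** word_prod l)^- in
  H r -> generated (canonical H) r.
Proof.
  intros HH Hy Hl Hs. revert y Hy. induction Hl as [|a l Ha Hl IH]; intros y Hy r Hr.
  - subst r. cbn in *. rewrite !gmul1r in *. apply generated_in.
    apply canonical_wall; assumption.
  - destruct (classic (H (y ** a ** y^-))) as [Hp|Hp].
    + pose proof (canonical_wall _ _ _ HH Hy Ha Hp) as Cp.
      set (p := y ** a ** y^-) in *.
      specialize (IH y Hy). cbn zeta in IH.
      replace (y ** word_prod l ** s ** (y ** word_prod l)^-) with (p^- ** r ** p) in IH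
        by (subst p r; rewrite word_prod_cons; gsimp; reflexivity).
      replace r with (p ** (p^- ** r ** p) ** p^-) by (gsimp; reflexivity).
      pose proof (generated_in (canonical H) p Cp).
      destruct HH as (_ & HM & HV).
      apply generated_mul; [apply generated_mul|apply generated_inv]; auto.
    + specialize (IH (y ** a)). cbn zeta in IH. revert Hr. subst r. rewrite word_prod_cons.
      rewrite !gmulA. apply IH. intros u Hu. rewrite (eta_wall H); auto.
      apply eqW_neq. intros ->. contradiction.
Qed.

Lemma canonical_generates (H : W -> Prop) r : is_subgroup H -> refl r -> H r ->
  generated (canonical H) r.
Proof.
  intros HH (w & s & Hs & ->) Hr.
  destruct (word_exists (cS C) w) as (l & Hl & <-); [auto | apply cS_generates|].
  pose proof (refl_generated_canonical H l gone s HH) as G. cbn zeta in G.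
  rewrite !gmul1l in G. apply G; auto. intros u _. apply eta_one.
Qed.

(** * Dihedral reflection subgroups *)

Definition gen2 t r : W -> Prop := generated (fun z => z = t \/ z = r).

Lemma gen2_l t r : gen2 t r t.
Proof. apply generated_in. auto. Qed.

Lemma gen2_r t r : gen2 t r r.
Proof. apply generated_in. auto. Qed.

(** Conjugation by [r] inverts [t r], so the rotations, together with their products with [r], are
    closed under multiplication by [t] and [r]. *)
Lemma gen2_form t r w : refl t -> refl r -> gen2 t r w ->
  exists e, generated (eq (t ** r)) e /\ r ** e = e^- ** r /\ (w = e \/ w = e ** r).
Proof.
  intros Ht Hr Hw. apply refl_invol in Ht, Hr.
  assert (Hrot : forall e, generated (eq (t ** r)) e -> r ** e = e^- ** r).
  { assert (comm_inv : forall e, generated (eq (t ** r)) e ->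
      e ** (t ** r) = t ** r ** e /\ e ** (t ** r)^- = (t ** r)^- ** e).
    { intros e He. split; apply (generated_comm (eq (t ** r))); try assumption;
        try apply generated_inv; try (apply generated_in; reflexivity);
        intros a b <- <-; reflexivity. }
    intros e He. induction He as [|x e <- He IH|x e <- He IH].
    - gsimp. reflexivity.
    - rewrite <- (proj1 (comm_inv e He)) at 1; rewrite gmulA, IH. gsimp_invol. reflexivity.
    - rewrite <- (proj2 (comm_inv e He)) at 1; rewrite gmulA, IH. gsimp_invol. reflexivity. }
  assert (Hstep : forall x e, x = t \/ x = r -> generated (eq (t ** r)) e ->
    exists e', generated (eq (t ** r)) e' /\ x ** e = e' ** r).
  { intros x e [-> | ->] He.
    - exists (t ** r ** e^-). split.
      + apply gen_l; auto using generated_inv.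
      + rewrite <- gmulA, <- (Hrot _ He). gsimp_invol. reflexivity.
    - exists (e^-). auto using generated_inv. }
  assert (Hform : forall x w, x = t \/ x = r ->
    (exists e, generated (eq (t ** r)) e /\ (w = e \/ w = e ** r)) ->
    exists e, generated (eq (t ** r)) e /\ (x ** w = e \/ x ** w = e ** r)).
  { intros x w' Hx (e & He & E). destruct (Hstep x e Hx He) as (e' & He' & E').
    exists e'. split; [exact He'|]. destruct E as [->| ->]; [auto|].
    left. rewrite gmulA, E'. gsimp_invol. reflexivity. }
  cut (exists e, generated (eq (t ** r)) e /\ (w = e \/ w = e ** r)).
  { intros (e & He & E). exists e. auto. }
  induction Hw as [|x w Hx _ IH|x w Hx _ IH].
  - exists gone. split; [constructor | auto].
  - auto.
  - replace (x^-) with x; [auto|]. symmetry. apply ginv_invol. destruct Hx; congruence.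
Qed.

Lemma gen2_refl_form t r a : refl t -> refl r -> gen2 t r a -> refl a ->
  exists e, generated (eq (t ** r)) e /\ r ** e = e^- ** r /\ a = e ** r.
Proof.
  intros Ht Hr Ha Ra. destruct (gen2_form _ _ _ Ht Hr Ha) as (e & He & Ee & [->| ->]).
  - exfalso. apply sgn_refl in Ra, Ht, Hr. clear Ee Ha.
    enough (sgn e = false) by congruence. clear Ra.
    assert (Htr : sgn (t ** r) = false) by (rewrite sgn_mul, Ht, Hr; reflexivity).
    induction He as [|x e <- He IH|x e <- He IH].
    + apply sgn_one.
    + rewrite sgn_mul, IH, Htr. reflexivity.
    + rewrite sgn_mul, sgn_inv, IH, Htr. reflexivity.
  - exists e. auto.
Qed.

(** For [a = e r], [b = f r], [d = g r] the product is [e f^-1 g r], which is symmetric in [e] and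
    [g] because rotations commute. *)
Lemma gen2_triple t r a b d : refl t -> refl r ->
  gen2 t r a -> gen2 t r b -> gen2 t r d -> refl a -> refl b -> refl d ->
  a ** b ** d = d ** b ** a.
Proof.
  intros Ht Hr Ha Hb Hd Ra Rb Rd.
  destruct (gen2_refl_form _ _ _ Ht Hr Ha Ra) as (e & He & Ee & ->).
  destruct (gen2_refl_form _ _ _ Ht Hr Hb Rb) as (f & Hf & Ef & ->).
  destruct (gen2_refl_form _ _ _ Ht Hr Hd Rd) as (g & Hg & Eg & ->).
  pose proof (refl_invol _ Hr) as rr.
  replace (e ** r ** (f ** r) ** (g ** r)) with (e ** (r ** f) ** r ** (g ** r))
    by (gsimp; reflexivity).
  replace (g ** r ** (f ** r) ** (e ** r)) with (g ** (r ** f) ** r ** (e ** r))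
    by (gsimp; reflexivity).
  rewrite Ef. gsimp_invol. rewrite !(gmulA _ _ _ r). f_equal.
  assert (comm : forall x y, generated (eq (t ** r)) x -> generated (eq (t ** r)) y ->
    x ** y = y ** x).
  { intros x y Hx Hy. apply (generated_comm (eq (t ** r))); try assumption.
    intros a b <- <-. reflexivity. }
  rewrite (comm e), (comm (f^-)), <- !gmulA; auto using generated_inv, generated_mul.
Qed.

Section Canonical.
Variable H : W -> Prop.
Hypothesis HM : forall x y, H x -> H y -> H (x ** y).

Lemma canonical_invol p : canonical H p -> p ** p = gone.
Proof. intros (_ & Rp & _). apply refl_invol, Rp. Qed.

(** Evaluating both sides at [b] forces [d b d = b]; then [b d b = d], so [a = d]. *)
Lemma canonical_neq_conj a b d : canonical H a -> canonical H b -> canonical H d ->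
  a <> b -> a <> d -> b <> d -> a <> b ** d ** b.
Proof.
  intros Ca Cb Cd nab nad nbd E.
  pose proof (canonical_invol _ Cb) as bb. pose proof (canonical_invol _ Cd) as dd.
  destruct Ca as (Ha & _ & Ea), Cb as (Hb & _ & Eb), Cd as (Hd & _ & Ed).
  assert (F : eta (b ** d ** b) b = false).
  { rewrite <- E, Ea, eqW_neq; auto. }
  rewrite !eta_mul in F.
  replace ((b ** d)^- ** b ** (b ** d)) with (d ** b ** d) in F
    by (gsimp_invol; reflexivity).
  replace (b^- ** b ** b) with b in F by (gsimp; reflexivity).
  rewrite !Eb, Ed, (proj2 (eqWP b b) eq_refl), (eqW_neq b d) in F by auto.
  destruct (eqW (d ** b ** d) b) eqn:E'; [|discriminate].
  apply eqWP in E'. apply nad. rewrite E, <- E' at 1. gsimp_invol. reflexivity.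
Qed.

(* Compare the values at d of the cocycle on the two sides of a b d = d b a. *)
Lemma canonical_triple_comm a b d : canonical H a -> canonical H b -> canonical H d ->
  a <> b -> a <> d -> b <> d ->
  a ** b ** d = d ** b ** a -> a ** b = b ** a.
Proof.
  intros Ca Cb Cd nab nad nbd E.
  pose proof (canonical_invol _ Ca) as aa.
  pose proof (canonical_invol _ Cb) as bb. pose proof (canonical_invol _ Cd) as dd.
  pose proof (canonical_neq_conj b a d Cb Ca Cd) as N1.
  pose proof (canonical_neq_conj a b d Ca Cb Cd) as N2.
  destruct Ca as (Ha & _ & Ea), Cb as (Hb & _ & Eb), Cd as (Hd & _ & Ed).
  assert (F : eta (a ** b ** d) d = eta (d ** b ** a) d) by (rewrite E; reflexivity).
  rewrite !eta_mul in F.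
  replace (d^- ** d ** d) with d in F by (gsimp; reflexivity).
  replace ((d ** b)^- ** d ** (d ** b)) with (b ** d ** b) in F by (gsimp_invol; reflexivity).
  replace (a^- ** d ** a) with (a ** d ** a) in F by (gsimp_invol; reflexivity).
  replace ((a ** b)^- ** d ** (a ** b)) with (b ** a ** d ** a ** b) in F
    by (gsimp_invol; reflexivity).
  rewrite !Ea, !Eb, !Ed in F by auto.
  rewrite (eqW_neq d a), (eqW_neq d b), (eqW_neq (a ** d ** a) b),
    (eqW_neq (b ** d ** b) a), (proj2 (eqWP d d) eq_refl) in F by (auto; apply not_eq_sym; auto).
  (* The surviving terms say that [d] commutes with [a b]; hence [d a b = a b d = d b a]. *)
  cbn in F. apply eqWP in F.
  apply (gcancel_r d). rewrite E, <- F at 1. gsimp_invol. reflexivity.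
Qed.

End Canonical.

(** Canonical generators generate [t] and [r], so they only have to be counted. A single one would
    generate a group with one nontrivial element, against [t <> r]; a third is excluded by
    commutation. *)
Lemma gen2_canonical t r : refl t -> refl r -> t <> r ->
  exists p q, p <> q /\ canonical (gen2 t r) p /\ canonical (gen2 t r) q /\
    forall w, gen2 t r w -> gen2 p q w.
Proof.
  intros Ht Hr Hne. set (H := gen2 t r).
  assert (HH : is_subgroup H) by apply generated_subgroup.
  pose proof (canonical_generates H t HH Ht (gen2_l t r)) as Gt.
  pose proof (canonical_generates H r HH Hr (gen2_r t r)) as Gr.
  assert (Hpq : exists p q, canonical H p /\ canonical H q /\ p <> q).
  { apply NNPP. intros Hno.
    assert (Heq : forall p q, canonical H p -> canonical H q -> p = q).
    { intros p q Cp Cq. apply NNPP. intros npq. apply Hno. exists p, q. auto. }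
    assert (Hall : forall w, generated (canonical H) w -> w = gone \/ canonical H w).
    { intros w Hw. induction Hw as [|x w Hx _ IH|x w Hx _ IH]; [auto| |];
      rewrite ?(ginv_invol x (canonical_invol _ _ Hx));
      (destruct IH as [->|Cw]; [rewrite gmul1r; auto|]);
      left; rewrite (Heq w x Cw Hx); apply (canonical_invol _ _ Hx). }
    assert (Hone : forall x, refl x -> x <> gone).
    { intros x Rx ->. apply sgn_refl in Rx. rewrite sgn_one in Rx. discriminate. }
    destruct (Hall t Gt) as [|Ct]; [apply (Hone t); assumption|].
    destruct (Hall r Gr) as [|Cr]; [apply (Hone r); assumption|].
    apply Hne, Heq; assumption. }
  destruct Hpq as (p & q & Cp & Cq & npq). exists p, q.
  split; [exact npq|]. split; [exact Cp|]. split; [exact Cq|].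
  cut (forall z, canonical H z -> z = p \/ z = q).
  { intros Hz w Hw. apply (generated_bind (fun z => z = t \/ z = r)); [|exact Hw].
    intros y [-> | ->]; eapply generated_bind; try eassumption;
      intros z Cz; apply generated_in, Hz, Cz. }
  (* With a third canonical generator all of them commute, so t and r do too; but
     then t and r are the only reflections of the subgroup. *)
  intros z Cz. apply NNPP. intros Hno.
  assert (nzp : z <> p) by tauto. assert (nzq : z <> q) by tauto.
  assert (Hcomm : forall a b d, canonical H a -> canonical H b -> canonical H d ->
            a <> b -> a <> d -> b <> d -> a ** b = b ** a).
  { intros a b d Ca Cb Cd nab nad nbd.
    apply (canonical_triple_comm H (proj1 (proj2 HH))) with (d := d); try assumption.
    destruct Ca as (Ha & Ra & _), Cb as (Hb & Rb & _), Cd as (Hd & Rd & _).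
    apply (gen2_triple t r); assumption. }
  assert (Hcomm2 : forall a b, canonical H a -> canonical H b -> a ** b = b ** a).
  { intros a b Ca Cb. destruct (classic (a = b)) as [->|nab]; [reflexivity|].
    destruct (classic (a = p)) as [Ep|]; [|destruct (classic (b = p)) as [Ep|]].
    - destruct (classic (b = q)).
      + apply (Hcomm a b z); congruence.
      + apply (Hcomm a b q); congruence.
    - destruct (classic (a = q)).
      + apply (Hcomm a b z); congruence.
      + apply (Hcomm a b q); congruence.
    - apply (Hcomm a b p); congruence. }
  assert (tr : t ** r = r ** t) by (eapply generated_comm; eassumption).
  pose proof (refl_invol _ Ht) as tt. pose proof (refl_invol _ Hr) as rr.
  assert (Hcases : forall w, H w -> refl w -> w = t \/ w = r).
  { intros w Hw Rw. destruct (gen2_refl_form _ _ _ Ht Hr Hw Rw) as (e & He & _ & ->).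
    cut (e = gone \/ e = t ** r).
    { intros [-> | ->]; gsimp_invol; auto. }
    clear Hw Rw. induction He as [|x e <- _ [-> | ->]|x e <- _ [-> | ->]].
    - auto.
    - right. gsimp_invol. reflexivity.
    - left. rewrite tr at 1. gsimp_invol. reflexivity.
    - right. gsimp_invol. symmetry. exact tr.
    - left. gsimp_invol. reflexivity. }
  destruct Cp as (Hp & Rp & _), Cq as (Hq & Rq & _), Cz as (Hz & Rz & _).
  destruct (Hcases p Hp Rp), (Hcases q Hq Rq), (Hcases z Hz Rz); congruence.
Qed.

(** * Reduced alternating words *)

Section Alternating.
Variable H : W -> Prop.
Hypothesis HH : is_subgroup H.

(* Equivalently, n is at most the (possibly infinite) order of p q. *)
Definition reduced p q n : Prop := forall i, 0 < i < n -> alt p q (2 * i) <> gone.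

Lemma reduced_swap p q n : q ** q = gone -> reduced p q n -> reduced q p n.
Proof.
  intros qq Hn i Hi E. apply (Hn i Hi), alt_even_swap; assumption.
Qed.

Lemma reduced_le p q m n : m <= n -> reduced p q n -> reduced p q m.
Proof. intros Hmn Hn i Hi. apply Hn. lia. Qed.

Lemma alt_in p q n : H p -> H q -> H (alt p q n).
Proof.
  destruct HH as (H1 & HM & _). intros Hp Hq. revert p q Hp Hq.
  induction n as [|n IH]; intros p q Hp Hq; [exact H1|]. cbn. auto.
Qed.

Lemma refl_alt p q i : refl p -> refl q -> refl (alt p q (2 * i + 1)).
Proof.
  revert p q. induction i as [|i IH]; intros p q Rp Rq.
  - cbn. rewrite gmul1r. exact Rp.
  - pose proof (refl_conj p _ (IH q p Rq Rp)) as R.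
    rewrite (refl_inv p Rp), alt_odd_conj in R. exact R.
Qed.

(** Removing the first letter of the word conjugates the palindrome into one with two more letters;
    [n + i] is unchanged, so the bound on the order survives the induction. *)
Lemma eta_alt_other p q n i : canonical H p -> canonical H q ->
  reduced p q (n + i + 1) -> eta (alt p q n) (alt q p (2 * i + 1)) = false.
Proof.
  revert p q i. induction n as [|n IH]; intros p q i Cp Cq Hred.
  - apply eta_one.
  - pose proof (canonical_invol _ _ Cp) as pp. pose proof (canonical_invol _ _ Cq) as qq.
    assert (Hin : H (alt q p (2 * i + 1))) by (apply alt_in; [apply Cq | apply Cp]).
    cbn [alt]. rewrite eta_mul, (proj2 (proj2 Cp) _ Hin), (ginv_invol p pp).
    assert (Hred' : reduced q p (n + S i + 1)).
    { replace (n + S i + 1) with (S n + i + 1) by lia. apply reduced_swap; assumption. }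
    rewrite alt_odd_conj, (IH _ _ _ Cq Cp Hred').
    rewrite eqW_neq; [reflexivity|]. intros E.
    apply (Hred (S i)); [lia|].
    replace (2 * S i) with (S (2 * i + 1)) by lia. cbn [alt]. rewrite E. exact pp.
Qed.

(** The walls of a reduced word are the palindromes on its first letter; [reduced p q (S i)] keeps
    those of index at most [i] distinct. *)
Lemma eta_alt p q n i : canonical H p -> canonical H q ->
  reduced p q n -> reduced p q (S i) ->
  eta (alt p q n) (alt p q (2 * i + 1)) = (i <? n).
Proof.
  revert p q i. induction n as [|n IH]; intros p q i Cp Cq Hn Hi.
  - cbn. apply eta_one.
  - pose proof (canonical_invol _ _ Cp) as pp. pose proof (canonical_invol _ _ Cq) as qq.
    assert (Hin : H (alt p q (2 * i + 1))) by (apply alt_in; [apply Cp | apply Cq]).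
    cbn [alt]. rewrite eta_mul, (proj2 (proj2 Cp) _ Hin), (ginv_invol p pp).
    destruct i as [|i].
    + replace (alt p q (2 * 0 + 1)) with p by (symmetry; apply gmul1r).
      rewrite (proj2 (eqWP p p) eq_refl). rewrite pp, gmul1l.
      pose proof (eta_alt_other q p n 0 Cq Cp) as E. cbn in E. rewrite gmul1r in E.
      rewrite E; [reflexivity|]. apply reduced_swap; [exact qq|].
      replace (n + 0 + 1) with (S n) by lia. exact Hn.
    + rewrite <- alt_odd_conj.
      replace (p ** (p ** alt q p (2 * i + 1) ** p) ** p) with (alt q p (2 * i + 1))
        by (gsimp_invol; reflexivity).
      assert (Hn' : reduced q p n)
        by (apply reduced_swap; [exact qq | apply reduced_le with (2 := Hn); lia]).
      assert (Hi' : reduced q p (S i))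
        by (apply reduced_swap; [exact qq | apply reduced_le with (2 := Hi); lia]).
      rewrite (IH _ _ _ Cq Cp Hn' Hi').
      rewrite eqW_neq; [reflexivity|]. intros E.
      apply (Hi (S i)); [lia|]. apply (gcancel_r p).
      rewrite alt_even_S, <- alt_odd_conj, gmul1l. exact E.
Qed.

(** A word with the fewest letters is reduced: a relation [(p q)^i = 1] with [i < n] would either
    fold it or delete [2 i] of its letters. *)
Lemma gen2_alt p q w : p ** p = gone -> q ** q = gone -> gen2 p q w ->
  exists n, reduced p q n /\ (w = alt p q n \/ w = alt q p n).
Proof.
  intros pp qq Hw.
  assert (Hex : exists n, w = alt p q n \/ w = alt q p n).
  { assert (Hstep : forall x w, x = p \/ x = q -> (exists n, w = alt p q n \/ w = alt q p n) ->
      exists n, x ** w = alt p q n \/ x ** w = alt q p n).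
    { intros x v [-> | ->] (n & [-> | ->]).
      - destruct n as [|n]; [exists 1; auto|]. exists n. right. cbn. apply gmul_invol_l, pp.
      - exists (S n). auto.
      - exists (S n). auto.
      - destruct n as [|n]; [exists 1; auto|]. exists n. left. cbn. apply gmul_invol_l, qq. }
    induction Hw as [|x w Hx _ IH|x w Hx _ IH].
    - exists 0. auto.
    - auto.
    - replace (x^-) with x; [auto|]. symmetry. apply ginv_invol. destruct Hx; congruence. }
  destruct (nat_least _ Hex) as (n & Hn & Hmin). exists n. split; [|exact Hn].
  intros i Hi E. pose proof (alt_even_swap _ _ i pp E) as E'.
  assert (exists m, m < n /\ alt p q n = alt q p m /\ alt q p n = alt p q m \/
                    m < n /\ alt p q n = alt p q m /\ alt q p n = alt q p m) as (m & Hm).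
  { destruct (le_lt_dec n (2 * i)) as [Hle|Hlt].
    - exists (2 * i - n). left. split; [lia|].
      split; apply alt_fold with (m := i); auto; lia.
    - exists (n - 2 * i). right. split; [lia|].
      replace n with (2 * i + (n - 2 * i)) at 1 3 by lia.
      rewrite !alt_even_add, E, E', !gmul1l. auto. }
  assert (n <= m); [apply Hmin|lia].
  destruct Hm as [(_ & E1 & E2)|(_ & E1 & E2)]; rewrite <- E1, <- E2; tauto.
Qed.

Lemma bg_arrow_refl x t : refl t -> eta x t = false -> bg_arrow x (t ** x).
Proof.
  intros Rt E. split; [|apply bruhat_lt_refl; assumption].
  gsimp. rewrite (refl_inv _ Rt). exact Rt.
Qed.

Lemma bg_arrow_len x y : bg_arrow x y -> len x < len y.
Proof.
  intros [_ [Hle Hne]]. destruct (bruhat_le_len _ _ Hle); [contradiction | assumption].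
Qed.

(** Appending a letter on the right is left multiplication by the palindrome with [2 n + 1] letters;
    the other arrow prepends [q]. *)
Lemma alt_arrow p q n : canonical H p -> canonical H q -> reduced p q (S n) ->
  bg_arrow (alt p q n) (alt p q (S n)) /\ bg_arrow (alt p q n) (alt q p (S n)).
Proof.
  intros Cp Cq Hn.
  pose proof (canonical_invol _ _ Cp) as pp. pose proof (canonical_invol _ _ Cq) as qq.
  split.
  - pose proof (alt_odd_cancel p q n 0 pp qq) as E.
    replace (n + 2 * 0 + 1) with (S n) in E by lia.
    replace (n + 0) with n in E by lia. rewrite <- E.
    apply bg_arrow_refl; [apply refl_alt; [apply Cp | apply Cq]|].
    rewrite eta_alt; [apply Nat.ltb_irrefl| | | |]; try assumption.
    apply reduced_le with (2 := Hn). lia.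
  - cbn [alt]. apply bg_arrow_refl; [apply Cq|].
    pose proof (eta_alt_other p q n 0 Cp Cq) as E. cbn in E. rewrite gmul1r in E.
    apply E. replace (n + 0 + 1) with (S n) by lia. exact Hn.
Qed.

(** The path keeps the first letter [p] until the last arrow, which may change it. *)
Lemma alt_path p q n n' x : canonical H p -> canonical H q -> n < n' ->
  reduced p q n' -> x = alt p q n' \/ x = alt q p n' ->
  clos_refl_trans W (fun x y => H x /\ H y /\ bg_arrow x y) (alt p q n) x /\
  len (alt p q n) < len x.
Proof.
  intros Cp Cq. revert x. induction n' as [|m IH]; intros x Hlt Hred Hx; [lia|].
  assert (Hstep : (H (alt p q m) /\ H x /\ bg_arrow (alt p q m) x)).
  { destruct (alt_arrow p q m Cp Cq Hred).
    split; [apply alt_in; [apply Cp | apply Cq]|].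
    destruct Hx as [-> | ->]; (split; [apply alt_in; (apply Cp || apply Cq) | assumption]). }
  pose proof (bg_arrow_len _ _ (proj2 (proj2 Hstep))) as Hlen.
  destruct (Nat.eq_dec n m) as [->|Hne].
  - split; [apply rt_step, Hstep | exact Hlen].
  - destruct (IH (alt p q m)) as [Hpath Hlen'].
    + lia.
    + apply reduced_le with (2 := Hred). lia.
    + auto.
    + split; [|lia]. apply rt_trans with (1 := Hpath), rt_step, Hstep.
Qed.

(** If the word is too long, folding it at the order [m] of [p q] leaves [2 m - N] letters, and
    [n <= m]. *)
Lemma reduced_representative p q n N : p ** p = gone -> q ** q = gone -> n <= N <= 2 * n ->
  reduced p q n -> exists n', 2 * n - N <= n' /\ reduced p q n' /\
    (alt p q N = alt p q n' \/ alt p q N = alt q p n').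
Proof.
  intros pp qq HnN Hn. destruct (classic (reduced p q N)) as [HN|HN].
  - exists N. split; [lia | auto].
  - assert (Hex : exists i, 0 < i < N /\ alt p q (2 * i) = gone).
    { apply NNPP. intros Hno. apply HN. intros i Hi E. apply Hno. exists i. auto. }
    destruct (nat_least _ Hex) as (m & [Hm E] & Hmin).
    assert (Hred : reduced p q m).
    { intros i Hi Ei. assert (m <= i); [|lia]. apply Hmin. split; [lia | exact Ei]. }
    assert (n <= m) by (destruct (le_lt_dec n m); [assumption|]; exfalso; apply (Hn m); auto; lia).
    exists (2 * m - N). split; [lia|]. split.
    + apply reduced_le with (2 := Hred). lia.
    + right. apply alt_fold with (m := m); auto; lia.
Qed.

(** A nonempty reduced word has its first letter in its N-set, and a canonical [z] has only itself
    there. *)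
Lemma canonical_two p q z : canonical H p -> canonical H q ->
  (forall w, H w -> gen2 p q w) -> canonical H z -> z = p \/ z = q.
Proof.
  intros Cp Cq Hpq (Hz & Rz & Ez).
  assert (Hfirst : forall a b n, canonical H a -> canonical H b -> reduced a b n ->
            z = alt a b n -> z = a).
  { intros a b n Ca Cb Hn E. pose proof (eta_alt a b n 0 Ca Cb Hn) as F.
    rewrite <- E in F. cbn in F. rewrite gmul1r, Ez in F by apply Ca.
    symmetry. apply eqWP. rewrite F by (intros i Hi; lia).
    destruct n; [|reflexivity]. apply sgn_refl in Rz. rewrite E in Rz.
    cbn in Rz. rewrite sgn_one in Rz. discriminate. }
  destruct (gen2_alt p q z) as (n & Hn & [E|E]); eauto using canonical_invol, reduced_swap.
Qed.

Lemma dihedral_gen2 p q : p <> q -> canonical H p -> canonical H q ->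
  (forall w, H w -> gen2 p q w) -> dihedral H.
Proof.
  intros npq Cp Cq Hpq. exists p, q. split; [exact npq|]. intros z.
  rewrite <- canonicalP. split; [apply canonical_two; assumption|].
  intros [-> | ->]; assumption.
Qed.

(** The letter [g] following the first [n] depends on the parity of [n]; leaving it existential
    avoids a case distinction later. *)
Lemma alt_split p q n : p ** p = gone -> q ** q = gone ->
  exists g h, (g = p /\ h = q \/ g = q /\ h = p) /\
    (forall d, alt q p (n + d) = alt q p n ** alt g h d) /\
    (forall j, (alt q p n)^- ** alt p q (2 * j + 1) ** alt q p n = alt h g (2 * (n + j) + 1)).
Proof.
  intros pp qq. induction n as [|n (g & h & Hgh & Hadd & Hconj)].
  - exists q, p. split; [auto|]. split; intros; cbn [alt Nat.add]; gsimp; reflexivity.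
  - exists h, g. split; [tauto|].
    assert (gg : g ** g = gone) by (destruct Hgh as [[-> _]|[-> _]]; assumption).
    assert (ES : alt q p (S n) = alt q p n ** g).
    { replace (S n) with (n + 1) by lia. rewrite Hadd. cbn. rewrite gmul1r. reflexivity. }
    split; intros d.
    + replace (S n + d) with (n + S d) by lia. rewrite Hadd, ES. cbn [alt].
      apply gmulA.
    + rewrite ES. replace (S n + d) with (S (n + d)) by lia.
      rewrite <- alt_odd_conj, <- Hconj. gsimp_invol. reflexivity.
Qed.

Lemma sgn_alt p q n : refl p -> refl q -> sgn (alt p q n) = Nat.odd n.
Proof.
  intros Rp Rq. revert p q Rp Rq. induction n as [|n IH]; intros p q Rp Rq.
  - apply sgn_one.
  - cbn [alt]. rewrite sgn_mul, (sgn_refl _ Rp), IH by assumption.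
    rewrite Nat.odd_succ, <- Nat.negb_odd. reflexivity.
Qed.
End Alternating.

(* In the dihedral group H generated by t and the reflection r of x s = r x, write
   x = a x0 with x0 minimal in H x, and let p = x0 s x0^-1, which is canonical, and
   q be the other canonical generator. The hypotheses say that a^-1 = qpq... (k
   letters) and (t a)^-1 = pqp... (K letters) with k < K. As t <> r, the word
   qpq... of k + 1 letters lies strictly between those of a^-1 and (t a p)^-1, and
   t1, t2 are the corresponding reflections. *)
Lemma lifting_step x s t : cS C s -> refl t ->
  let r := x ** s ** x^- in t <> r ->
  eta x r = false -> eta x t = false -> eta (t ** x) (t ** r ** t^-) = true ->
  exists t1 t2, sqle' t1 t /\ sqle' t2 t /\ len t1 < len t /\ len t2 < len t /\
    eta x t1 = false /\ eta (t1 ** x) t2 = false /\ t2 ** (t1 ** x) = t ** x ** s.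
Proof.
  intros Hs Rt r ntr Exr Ext Etx.
  assert (Rr : refl r) by (apply refl_conj, refl_S, Hs).
  set (H := gen2 t r).
  assert (HH : is_subgroup H) by apply generated_subgroup.
  assert (Ht : H t) by apply gen2_l. assert (Hr : H r) by apply gen2_r.
  destruct (coset_min H x HH) as (a & x0 & Ha & Ex & Hx0).
  pose proof HH as (_ & HM & HV).
  set (p := x0 ** s ** x0^-).
  assert (Ep : p = a^- ** r ** a) by (subst p r; rewrite Ex; gsimp; reflexivity).
  assert (Hp : H p) by (rewrite Ep; auto).
  assert (Cp : canonical H p) by (apply canonical_wall; assumption).
  destruct (gen2_canonical t r Rt Rr ntr) as (p0 & q0 & npq0 & Cp0 & Cq0 & Hgen0).
  assert (Hq : exists q, p <> q /\ canonical H q /\ forall w, H w -> gen2 p q w).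
  { destruct (canonical_two H HH p0 q0 p Cp0 Cq0 Hgen0 Cp) as [->| ->].
    - exists q0. auto.
    - exists p0. split; [auto|]. split; [exact Cp0|]. intros w Hw.
      apply Hgen0 in Hw. revert Hw. apply generated_bind.
      intros y [-> | ->]; [apply gen2_r | apply gen2_l]. }
  destruct Hq as (q & npq & Cq & Hgen).
  assert (Hdih : dihedral H) by (apply (dihedral_gen2 H HH p q); assumption).
  assert (Hrefl : reflection_subgroup H).
  { exists (fun z => z = t \/ z = r). split; [|reflexivity].
    intros z [-> | ->]; assumption. }
  pose proof (canonical_invol _ _ Cp) as pp. pose proof (canonical_invol _ _ Cq) as qq.
  pose proof (refl_invol _ Rt) as tt.
  assert (Eat : eta a t = false) by (rewrite <- Ext, Ex; symmetry; apply (eta_coset H); assumption).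
  assert (Eap : eta (a^-) p = false).
  { rewrite eta_inv. replace (a ** p ** a^-) with r by (rewrite Ep; gsimp; reflexivity).
    rewrite <- Exr, Ex. symmetry. apply (eta_coset H); assumption. }
  assert (Etap : eta ((t ** a)^-) p = true).
  { rewrite eta_inv, <- Etx, Ex, gmulA, (eta_coset H (t ** a) x0) by auto.
    f_equal. rewrite Ep. gsimp. reflexivity. }
  assert (Hk : exists k, reduced p q k /\ a^- = alt q p k).
  { destruct (gen2_alt p q (a^-) pp qq) as (k & Hk & [E|E]); [auto| |eauto].
    exists k. split; [exact Hk|]. destruct k as [|k]; [exact E|].
    pose proof (eta_alt H HH p q (S k) 0 Cp Cq Hk) as F. rewrite <- E in F.
    cbn in F. rewrite gmul1r, Eap in F. discriminate F. intros i Hi. lia. }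
  assert (HK : exists K, reduced p q K /\ (t ** a)^- = alt p q K).
  { destruct (gen2_alt p q ((t ** a)^-) pp qq) as (K & HK & [E|E]); [auto|eauto|].
    exists K. split; [exact HK|]. rewrite E.
    (* A word on [q] contradicts [Etap] unless [K] is the order of [p q]; in that case the longest
       element is also a word on [p]. *)
    destruct (classic (reduced q p (S K))) as [HSK|HSK].
    - pose proof (eta_alt_other H HH q p K 0 Cq Cp) as F. cbn in F.
      rewrite gmul1r, <- E, Etap in F. discriminate F.
      replace (K + 0 + 1) with (S K) by lia. exact HSK.
    - assert (EK : alt q p (2 * K) = gone).
      { apply NNPP. intros EK. apply HSK. intros i Hi.
        destruct (Nat.eq_dec i K) as [->|]; [exact EK|].
        apply (reduced_swap p q K qq HK). lia. }
      apply alt_fold with (m := K); auto. lia. }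
  destruct Hk as (k & Hk & Ea), HK as (K & HK & Eta).
  assert (Hpar : Nat.odd K = negb (Nat.odd k)).
  { rewrite <- (sgn_alt p q K), <- (sgn_alt q p k), <- Ea, <- Eta;
      try apply Cp; try apply Cq.
    rewrite !sgn_inv, sgn_mul, (sgn_refl _ Rt). reflexivity. }
  assert (Hkq : reduced q p k) by (apply reduced_swap; assumption).
  assert (HKq : reduced q p K) by (apply reduced_swap; assumption).
  assert (HkK : k < K).
  { destruct (le_lt_dec K k) as [HKk|]; [|assumption]. exfalso.
    assert (exists i, k = 2 * i + 1 + K) as (i & Ei).
    { destruct (Nat.Even_or_Odd (k - K)) as [[i Ei]|[i Ei]].
      - replace k with (K + 2 * i) in Hpar by lia.
        rewrite Nat.odd_add_mul_2 in Hpar. destruct (Nat.odd K); discriminate.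
      - exists i. lia. }
    assert (F : eta (a^-) (a^- ** t ** a) = false).
    { rewrite eta_inv, <- Eat. f_equal. gsimp. reflexivity. }
    replace (a^- ** t ** a) with (alt q p (2 * i + 1)) in F.
    - rewrite Ea, (eta_alt H HH) in F; try assumption.
      + apply Nat.ltb_ge in F. lia.
      + apply reduced_le with (2 := Hkq). lia.
    - apply (gcancel_r ((t ** a)^-)). rewrite Eta at 1.
      rewrite <- alt_odd_add, <- Ei, <- Ea. gsimp_invol. reflexivity. }
  assert (exists j, K = 2 * j + 1 + k) as (j & EK).
  { destruct (Nat.Even_or_Odd (K - k)) as [[i Ei]|[i Ei]].
    - replace K with (k + 2 * i) in Hpar by lia.
      rewrite Nat.odd_add_mul_2 in Hpar. destruct (Nat.odd k); discriminate.
    - exists i. lia. }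
  assert (Eta' : (t ** a)^- = alt p q (2 * j + 1) ** a^-).
  { rewrite Eta, Ea, EK. apply alt_odd_add. }
  (* Here [K = k + 1] would give [(t a)^-1 = p a^-1], that is [t = r]. *)
  destruct j as [|j].
  { exfalso. apply ntr. cbn in Eta'. rewrite gmul1r, Ep in Eta'.
    revert Eta'. gsimp_invol. intros E. apply gcancel_l in E. exact E. }
  destruct (alt_split p q k pp qq) as (g & h & Hgh & Hadd & Hconj).
  assert (Cg : canonical H g) by (destruct Hgh as [[-> _]|[-> _]]; assumption).
  assert (Ch : canonical H h) by (destruct Hgh as [[_ ->]|[_ ->]]; assumption).
  pose proof (canonical_invol _ _ Cg) as gg. pose proof (canonical_invol _ _ Ch) as hh.
  assert (HKh : reduced h g K) by (destruct Hgh as [[-> ->]|[-> ->]]; assumption).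
  (* Deleting the initial [p] of [(t a)^-1] leaves the word on [q] with [K - 1 = k + 2 (j + 1)]
     letters. Past those of [a^-1] its first letter is [g], and the other [2 j + 1] form [t2]. *)
  set (t2 := alt h g (2 * j + 1)).
  assert (t2t2 : t2 ** t2 = gone) by (apply alt_odd_invol; assumption).
  assert (Ht2 : H t2) by (apply alt_in; [exact HH | apply Ch | apply Cg]).
  assert (Hg : H g) by apply Cg.
  assert (Et : t = alt h g (2 * (k + S j) + 1)).
  { rewrite <- Hconj, <- Ea, ginvK, <- gmulA, <- Eta'. gsimp_invol. reflexivity. }
  assert (Ek1 : alt q p (S k) = a^- ** g).
  { replace (S k) with (k + 1) by lia. rewrite Hadd, Ea. cbn. rewrite gmul1r. reflexivity. }
  assert (Ek2 : alt q p (k + 2 * S j) = a^- ** g ** t2).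
  { rewrite Hadd, <- Ea, <- gmulA. f_equal.
    replace (2 * S j) with (S (2 * j + 1)) by lia. reflexivity. }
  (* This word for [t] has [K + k] letters, so its reduced form has at least [K - k = 2 j + 3], more
     than [g] and [t2]. *)
  destruct (reduced_representative h g K (2 * (k + S j) + 1) hh gg) as (n & Hn & Hred & En);
    [lia | exact HKh |]. rewrite <- Et in En.
  assert (Hredg : reduced g h n) by (apply reduced_swap; assumption).
  destruct (alt_path H HH g h 1 n t Cg Ch) as [Hpath1 Hlen1]; [lia | exact Hredg | tauto |].
  destruct (alt_path H HH h g (2 * j + 1) n t Ch Cg) as [Hpath2 Hlen2];
    [lia | exact Hred | tauto |].
  replace (alt g h 1) with g in Hpath1, Hlen1 by (symmetry; apply gmul1r).
  exists g, t2. split; [|split; [|split; [exact Hlen1 | split; [exact Hlen2 | split; [|split]]]]].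
  - split; [apply Cg|]. split; [exact Rt|]. right. exists H. auto.
  - split; [apply refl_alt; [apply Ch | apply Cg]|]. split; [exact Rt|]. right. exists H. auto 6.
  - rewrite Ex, (eta_coset H) by auto.
    replace (eta a g) with (eta (a^-) (a^- ** g ** a))
      by (rewrite eta_inv; gsimp; reflexivity).
    pose proof (alt_odd_cancel q p k 0 qq pp) as F.
    replace (k + 2 * 0 + 1) with (S k) in F by lia.
    replace (k + 0) with k in F by lia.
    apply gmul_eq_r in F. rewrite Ek1, <- Ea, ginvK in F. rewrite <- F, Ea.
    rewrite (eta_alt H HH); try assumption; [apply Nat.ltb_irrefl|].
    apply reduced_le with (2 := HKq). lia.
  - rewrite Ex, gmulA, (eta_coset H) by auto.
    assert (Eg : (g ** a)^- = alt q p (S k)) by (rewrite Ek1; gsimp_invol; reflexivity).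
    replace (eta (g ** a) t2) with (eta ((g ** a)^-) ((g ** a)^- ** t2 ** (g ** a)))
      by (rewrite eta_inv; gsimp; reflexivity).
    pose proof (alt_odd_cancel q p (S k) j qq pp) as F.
    replace (S k + 2 * j + 1) with (k + 2 * S j) in F by lia.
    apply gmul_eq_r in F. rewrite Ek2, <- Eg, ginvK in F.
    replace ((g ** a)^- ** t2 ** (g ** a)) with (alt q p (2 * (S k + j) + 1))
      by (rewrite F; gsimp_invol; reflexivity).
    rewrite Eg, (eta_alt H HH); try assumption.
    + apply Nat.ltb_ge. lia.
    + apply reduced_le with (2 := HKq). lia.
    + apply reduced_le with (2 := HKq). lia.
  - replace (2 * S j + 1 + k) with (S (k + 2 * S j)) in EK by lia.
    rewrite EK in Eta. cbn [alt] in Eta. rewrite Ek2 in Eta.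
    apply (f_equal ginv) in Eta. rewrite ginvK in Eta.
    rewrite Ex, (gmulA _ t a), Eta.
    replace s with (x0^- ** p ** x0) by (subst p; gsimp; reflexivity).
    gsimp_invol. reflexivity.
Qed.

(** * Parabolic cosets *)

Section Parabolic.
Variable J : W -> Prop.
Hypothesis HJ : forall s, J s -> cS C s.

Definition coset_rep w x : Prop := WupJ J x /\ exists y, WJ J y /\ w = x ** y.

Lemma isPJ_coset_rep w x : isPJ J w x -> coset_rep w x.
Proof. intros (Hx & y & Hy & E & _). split; [exact Hx|]. exists y. auto. Qed.

Lemma WupJ_eta x s : WupJ J x -> J s -> eta x (x ** s ** x^-) = false.
Proof.
  intros Hx Hs. destruct (eta x _) eqn:E; [|reflexivity].
  apply eta_true_len in E. revert E. gsimp. specialize (Hx s Hs).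
  rewrite len_ltP in Hx. lia.
Qed.

(** The first letter of a shortest word over [J] works: were it a wall of the remainder, exchange
    within [J] would shorten the word. *)
Lemma parabolic_descent y : WJ J y -> y <> gone -> exists s, J s /\ eta y s = true.
Proof.
  intros Hy Hne.
  destruct (nat_least (fun n => exists l, Forall J l /\ length l = n /\ word_prod l = y))
    as (n & (l & Hl & El & E) & Hmin).
  { destruct (word_exists J y HJ Hy) as (l & Hl & E). exists (length l), l. auto. }
  destruct Hl as [|s l Hs Hl]; [exfalso; apply Hne; rewrite <- E; reflexivity|].
  exists s. split; [exact Hs|].
  rewrite <- E, word_prod_cons, eta_mul, (eta_S _ _ (HJ _ Hs)), (proj2 (eqWP s s) eq_refl).
  replace (s^- ** s ** s) with s by (gsimp; reflexivity).
  destruct (eta (word_prod l) s) eqn:F; [|reflexivity]. exfalso.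
  destruct (exchange J l s HJ Hl F) as (_ & l' & Hl' & El' & E').
  assert (n <= length l'); [|cbn in El; lia].
  apply Hmin. exists l'. rewrite <- E', <- E. auto.
Qed.

(** In [x^-1 = a x0] with [x0] minimal, a nontrivial [a] has a descent in [J], which is then a
    descent of [x^-1]. *)
Lemma WupJ_trivial x : WupJ J x -> eta_trivial (WJ J) (x^-).
Proof.
  intros Hx. pose proof (generated_subgroup J) as HH.
  destruct (coset_min (WJ J) (x^-) HH) as (a & x0 & Ha & E & Hx0).
  destruct (classic (a = gone)) as [->|Hne].
  - rewrite E, gmul1l. exact Hx0.
  - exfalso. destruct (parabolic_descent a Ha Hne) as (s & Hs & F).
    pose proof (WupJ_eta x s Hx Hs) as F'. rewrite <- eta_inv, E in F'.
    rewrite (eta_coset (WJ J)) in F'; auto; [congruence|].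
    apply generated_in, Hs.
Qed.

Lemma coset_rep_uniq w x x' : coset_rep w x -> coset_rep w x' -> x = x'.
Proof.
  intros (Hx & y & Hy & E) (Hx' & y' & Hy' & E').
  apply WupJ_trivial in Hx, Hx'. pose proof (generated_subgroup J) as HH.
  assert (Hb : WJ J (y' ** y^-)) by (apply generated_mul; [|apply generated_inv]; assumption).
  assert (Eb : x'^- = y' ** y^- ** x^-).
  { apply (gcancel_r w). rewrite E' at 1. rewrite E. gsimp. reflexivity. }
  destruct (classic (y' ** y^- = gone)) as [E1|Hne].
  - rewrite E1, gmul1l in Eb. apply (f_equal ginv) in Eb. rewrite !ginvK in Eb.
    symmetry. exact Eb.
  - exfalso. destruct (parabolic_descent _ Hb Hne) as (s & Hs & F).
    assert (Hs' : WJ J s) by (apply generated_in, Hs).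
    specialize (Hx' s Hs'). rewrite Eb, (eta_coset (WJ J)) in Hx'; auto. congruence.
Qed.

Lemma coset_rep_exists w : exists x, coset_rep w x.
Proof.
  destruct (coset_min (WJ J) (w^-) (generated_subgroup J)) as (a & x0 & Ha & E & Hx0).
  exists (x0^-). split.
  - intros s Hs. apply len_ltP.
    replace (x0^- ** s) with (x0^- ** s ** x0^-^- ** x0^-) by (gsimp; reflexivity).
    apply eta_false_len; [apply refl_conj, refl_S, HJ, Hs|].
    rewrite <- eta_inv, ginvK. apply Hx0, generated_in, Hs.
  - exists (a^-). split; [apply generated_inv, Ha|].
    rewrite <- (ginvK w), E. apply ginvM.
Qed.

Lemma coset_rep_mul w x y : WJ J y -> coset_rep w x -> coset_rep (w ** y) x.
Proof.
  intros Hy (Hx & z & Hz & ->). split; [exact Hx|]. exists (z ** y).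
  split; [apply generated_mul; assumption|]. symmetry. apply gmulA.
Qed.

(** A wall [t] of [x] that cancels in [x y] makes [x^-1 t x] a wall of [y], hence an element of
    [WJ]; but [x^-1] is trivial there. *)
Lemma coset_rep_eta u x t : coset_rep u x -> eta u t = false -> eta x t = false.
Proof.
  intros (Hx & y & Hy & ->) E. destruct (eta x t) eqn:F; [|reflexivity].
  rewrite eta_mul, F in E. destruct (eta y _) eqn:F'; [|discriminate].
  destruct (word_exists J y HJ Hy) as (l & Hl & <-).
  destruct (exchange J l _ HJ Hl F') as [Hin _].
  rewrite <- F. pose proof (WupJ_trivial x Hx _ Hin) as G.
  rewrite eta_inv in G. rewrite <- G. f_equal. gsimp. reflexivity.
Qed.

(** * Projection of chains *)

Section Ideal.
Variable X : W -> Prop.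
Hypothesis HX : order_ideal X.

Local Notation chain :=
  (clos_refl_trans W (fun x y => exists t, X t /\ y = t ** x /\ bruhat_lt x y)).

Lemma chain_coset_rep_step t u pu pv : X t -> eta u t = false ->
  coset_rep u pu -> coset_rep (t ** u) pv -> chain pu pv.
Proof.
  destruct HX as [HXR HXI].
  remember (len t) as n eqn:En. revert t En u pu pv.
  induction n as [n IH] using lt_wf_ind. intros t -> u x pv Xt Eut Hu Hv.
  assert (Rt : refl t) by auto.
  pose proof (coset_rep_eta u x t Hu Eut) as Ext.
  assert (Htx : coset_rep (t ** x) pv).
  { destruct Hu as (_ & y & Hy & ->).
    replace (t ** x) with (t ** (x ** y) ** y^-) by (gsimp; reflexivity).
    apply coset_rep_mul; [apply generated_inv, Hy | exact Hv]. }
  destruct Hu as [Hx _].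
  destruct (classic (WupJ J (t ** x))) as [Hup|Hup].
  { replace pv with (t ** x).
    - apply rt_step. exists t. rewrite bruhat_lt_refl by exact Rt. auto.
    - apply (coset_rep_uniq (t ** x)); [|exact Htx]. split; [exact Hup|].
      exists gone. split; [constructor | symmetry; apply gmul1r]. }
  assert (exists s, J s /\ ~ len_lt (t ** x) (t ** x ** s)) as (s & Hs & Hlen).
  { apply NNPP. intros Hno. apply Hup. intros s Hs. apply NNPP. intros Hlen.
    apply Hno. exists s. auto. }
  pose proof (HJ _ Hs) as Ss.
  assert (HsJ : WJ J s) by (apply generated_in, Hs).
  pose proof (WupJ_eta x s Hx Hs) as Exr.
  set (r := x ** s ** x^-) in *.
  destruct (classic (t = r)) as [Etr|Hne].
  { replace pv with x; [apply rt_refl|]. apply (coset_rep_uniq (t ** x)); [|exact Htx].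
    split; [exact Hx|]. exists s. split; [exact HsJ|]. rewrite Etr. subst r. gsimp. reflexivity. }
  destruct (lifting_step x s t Ss Rt Hne Exr Ext) as
    (t1 & t2 & Hsq1 & Hsq2 & Hl1 & Hl2 & Et1 & Et2 & E).
  { destruct (eta (t ** x) _) eqn:F; [reflexivity|]. exfalso. apply Hlen, len_ltP.
    apply eta_false_len in F; [|apply refl_conj, refl_conj, refl_S, Ss].
    revert F. gsimp. auto. }
  assert (Xt1 : X t1)
    by (apply (HXI t1 t); [apply Hsq1 | exact Rt | apply rt_step, Hsq1 | exact Xt]).
  assert (Xt2 : X t2)
    by (apply (HXI t2 t); [apply Hsq2 | exact Rt | apply rt_step, Hsq2 | exact Xt]).
  (* The projection of the middle vertex joins the two chains given by induction. *)
  destruct (coset_rep_exists (t1 ** x)) as (z & Hz).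
  apply rt_trans with z.
  - apply (IH _ Hl1 t1 eq_refl x); try assumption. split; [exact Hx|].
    exists gone. split; [constructor | symmetry; apply gmul1r].
  - apply (IH _ Hl2 t2 eq_refl (t1 ** x)); try assumption.
    rewrite E. apply coset_rep_mul; assumption.
Qed.

Lemma chain_coset_rep u v pu pv : chain u v ->
  coset_rep u pu -> coset_rep v pv -> chain pu pv.
Proof.
  intros Huv. revert pu pv.
  induction Huv as [u v (t & Xt & -> & Hlt)|u|u w v _ IH1 _ IH2]; intros pu pv Hu Hv.
  - apply (chain_coset_rep_step t u); try assumption.
    apply bruhat_lt_refl; [apply HX, Xt | exact Hlt].
  - rewrite (coset_rep_uniq u pu pv Hu Hv). apply rt_refl.
  - destruct (coset_rep_exists w) as (pw & Hw). apply rt_trans with pw; auto.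
Qed.

(** The length condition is automatic, since each Bruhat step increases the length. *)
Lemma leLX_chain u v : leLX X u v <-> chain u v.
Proof.
  split.
  - intros [-> | [_ H]]; [apply rt_refl | exact H].
  - intros H. cut (u = v \/ len u < len v).
    { intros [E|Hlt]; [left; exact E|]. right. rewrite len_ltP. auto. }
    induction H as [u v (t & _ & _ & [H Hne])|u|u w v _ IH1 _ IH2].
    + apply bruhat_le_len, H.
    + auto.
    + destruct IH1 as [-> | IH1]; [exact IH2|]. right. destruct IH2 as [<- | IH2]; lia.
Qed.

Lemma leLX_isPJ u v pu pv : leLX X u v -> isPJ J u pu -> isPJ J v pv -> leLX X pu pv.
Proof.
  rewrite !leLX_chain. intros H Hu Hv.
  apply (chain_coset_rep u v); auto using isPJ_coset_rep.
Qed.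
End Ideal.
End Parabolic.

(** * Length bounds define order ideals of reflections *)

Lemma sqle_len t t' : sqle t t' -> len t <= len t'.
Proof.
  intros H. induction H as
    [t t' (_ & _ & [-> | (W' & _ & _ & _ & _ & Hpath)])|t|t t' t'' _ IH1 _ IH2].
  - reflexivity.
  - induction Hpath as [x y (_ & _ & Hxy)|x|x y z _ IH1 _ IH2].
    + apply Nat.lt_le_incl, bg_arrow_len, Hxy.
    + reflexivity.
    + lia.
  - reflexivity.
  - lia.
Qed.

Lemma Tk_order_ideal k : order_ideal (Tk (C := C) k).
Proof.
  split; [intros t [Rt _]; exact Rt|].
  intros t t' Rt Rt' Hsq [_ (n & Hn & Hk)]. split; [exact Rt|].
  exists (len t). split; [apply lenP|]. apply is_len_uniq in Hn. subst n.
  apply sqle_len in Hsq. etransitivity; [|exact Hk].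
  apply Nat.Div0.div_le_mono. lia.
Qed.
End Coxeter.

Theorem theorem3p8 (C : CoxeterSystem) (J : C -> Prop)
  (HJ : forall s, J s -> cS C s) :
  (forall X : C -> Prop, order_ideal X ->
     forall u v pu pv : C, leLX X u v -> isPJ J u pu -> isPJ J v pv ->
       leLX X pu pv) /\
  (forall (k : nat) (u v pu pv : C), leLk k u v -> isPJ J u pu -> isPJ J v pv ->
       leLk k pu pv).
Proof.
  split.
  - intros X HX u v pu pv. apply leLX_isPJ; assumption.
  - intros k u v pu pv. apply leLX_isPJ; [exact HJ | apply Tk_order_ideal].
Qed.
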